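(* Let $\epsilon>0$ and suppose that $\Phi$ admits an $(L,\epsilon/2)$-approximation $\Psi$, where $L>0$. Then for any global minimizer $x^*$ of the constrained problem $\min\{\Phi(x):x\in S\}$, there exists $\lambda^*>0$ such that $x^*$ is an $\epsilon$-minimizer of the penalty problem $\min_{x\in S_1}F_\lambda(x)$ whenever $\lambda\ge\lambda^*$, i.e. $$F_\lambda(x^* )\le\inf_{x\in S_1}F_\lambda(x)+\epsilon .$$ In particular, one can take $\lambda^*=CL$, where $C>0$ is an error bound constant, i.e. a constant such that for all $x\in\mathbb{R}^n$ $$\mathrm{dist}(x,S)\le C\left[(\|Ax-b\|^2-\sigma^2)_+ +\|(Bx-h)_+\|_1+\|(Dx-d)_+\|_1\right].$$
   Context: Standing setting. $\Phi:\mathbb{R}^n\to\mathbb{R}$ is a nonnegative continuous function. $A\in\mathbb{R}^{m\times n}$ has full row rank, $b\in\mathbb{R}^m$, $\sigma\ge 0$, $B\in\mathbb{R}^{\ell\times n}$, $h\in\mathbb{R}^\ell$, and $D$, $d$ are a matrix and a vector of compatible sizes. $S_1=\{x\in\mathbb{R}^n: Dx\le d\}$, $S_2=\{x\in\mathbb{R}^n:\|Ax-b\|\le\sigma,\ Bx\le h\}$, $S=S_1\cap S_2$ (inequalities componentwise, $\|\cdot\|$ Euclidean), and there exists $x_0\in S$ with $\|Ax_0-b\|<\sigma$. For a vector (or scalar) $a$, $a_+$ has entries $\max\{a_i,0\}$; $\mathrm{dist}(x,S)=\inf_{y\in S}\|x-y\|$. A constant $C>0$ satisfying the displayed error bound always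 exists in this setting (a known result of Luo and Luo). For $\lambda>0$, $$F_\lambda(x)=\lambda\left[(\|Ax-b\|^2-\sigma^2)_+ +\|(Bx-h)_+\|_1\right]+\Phi(x).$$ A point $x_\epsilon$ is an $\epsilon$-minimizer of $\min_{x\in S_1}F_\lambda(x)$ if $x_\epsilon\in S_1$ and $F_\lambda(x_\epsilon)\le\inf_{x\in S_1}F_\lambda(x)+\epsilon$. A globally Lipschitz continuous function $\Psi:\mathbb{R}^n\to\mathbb{R}$ with Lipschitz constant $L$ is an $(L,\epsilon)$-approximation to $\Phi$ if $0\le\Psi(x)-\Phi(x)\le\epsilon$ for all $x$. *)

(* Defs.v *)
From mathcomp Require Import all_boot all_order all_algebra.
From mathcomp Require Import all_classical all_reals all_analysis.

Set Implicit Arguments.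
Unset Strict Implicit.
Unset Printing Implicit Defensive.

Import Order.TTheory GRing.Theory Num.Theory.
Import numFieldNormedType.Exports.

Local Open Scope classical_set_scope.
Local Open Scope ring_scope.

(* R^k is 'cV[R]_k.  The library norm on matrices is the sup norm, so the
   Euclidean norm is introduced here; both induce the same topology, hence
   [continuous Phi] has its usual meaning for Phi : 'cV[R]_k -> R. *)
Definition norm2 (R : realType) (k : nat) (x : 'cV[R]_k) : R :=
  Num.sqrt (\sum_i x i 0 ^+ 2).

Definition norm1 (R : realType) (k : nat) (x : 'cV[R]_k) : R :=
  \sum_i `|x i 0|.

Definition pos_part (R : realType) (a : R) : R := Num.max a 0.

Definition pos_part_vec (R : realType) (k : nat) (x : 'cV[R]_k) : 'cV[R]_k :=
  map_mx (@pos_part R) x.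

Definition le_vec (R : realType) (k : nat) (x y : 'cV[R]_k) : Prop :=
  forall i, x i 0 <= y i 0.

(* [inf] is a real-valued infimum with value 0 on the empty set; below, dist_set is
   only used for nonempty S. *)
Definition dist_set (R : realType) (n : nat) (x : 'cV[R]_n) (S : set 'cV[R]_n) : R :=
  inf [set norm2 (x - y) | y in S].

Definition S1 (R : realType) (n p : nat) (D : 'M[R]_(p, n)) (d : 'cV[R]_p) :
    set 'cV[R]_n :=
  [set x | le_vec (D *m x) d].

Definition S2 (R : realType) (n m l : nat) (A : 'M[R]_(m, n)) (b : 'cV[R]_m)
    (sigma : R) (B : 'M[R]_(l, n)) (h : 'cV[R]_l) : set 'cV[R]_n :=
  [set x | norm2 (A *m x - b) <= sigma /\ le_vec (B *m x) h].

Definition penalized (R : realType) (n m l : nat) (A : 'M[R]_(m, n)) (b : 'cV[R]_m)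
    (sigma : R) (B : 'M[R]_(l, n)) (h : 'cV[R]_l) (Phi : 'cV[R]_n -> R)
    (lambda : R) (x : 'cV[R]_n) : R :=
  lambda * (pos_part (norm2 (A *m x - b) ^+ 2 - sigma ^+ 2)
            + norm1 (pos_part_vec (B *m x - h)))
  + Phi x.

Definition error_bound_constant (R : realType) (n m l p : nat)
    (A : 'M[R]_(m, n)) (b : 'cV[R]_m) (sigma : R)
    (B : 'M[R]_(l, n)) (h : 'cV[R]_l) (D : 'M[R]_(p, n)) (d : 'cV[R]_p)
    (C : R) : Prop :=
  0 < C /\
  forall x : 'cV[R]_n,
    dist_set x (S1 D d `&` S2 A b sigma B h) <=
    C * (pos_part (norm2 (A *m x - b) ^+ 2 - sigma ^+ 2)
         + norm1 (pos_part_vec (B *m x - h))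
         + norm1 (pos_part_vec (D *m x - d))).

Definition global_minimizer (R : realType) (n : nat) (f : 'cV[R]_n -> R)
    (S : set 'cV[R]_n) (x : 'cV[R]_n) : Prop :=
  S x /\ forall y, S y -> f x <= f y.

(* As for [dist_set], the infimum is a genuine one only when f is bounded below on
   a nonempty S, as is [penalized] on S1 when Phi and lambda are nonnegative. *)
Definition eps_minimizer (R : realType) (n : nat) (f : 'cV[R]_n -> R)
    (S : set 'cV[R]_n) (eps : R) (x : 'cV[R]_n) : Prop :=
  S x /\ f x <= inf [set f y | y in S] + eps.

Definition lipschitz_with (R : realType) (n : nat) (L : R)
    (f : 'cV[R]_n -> R) : Prop :=
  forall x y, `|f x - f y| <= L * norm2 (x - y).

Definition lipschitz_approximation (R : realType) (n : nat) (L eps : R)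
    (Phi Psi : 'cV[R]_n -> R) : Prop :=
  lipschitz_with L Psi /\ forall x, 0 <= Psi x - Phi x <= eps.

(* Main.v *)
Require Import Defs.
From mathcomp Require Import all_boot all_order all_algebra.
From mathcomp Require Import all_classical all_reals all_analysis.
From mathcomp Require Import ring lra.

Set Implicit Arguments.
Unset Strict Implicit.
Unset Printing Implicit Defensive.

Import Order.TTheory GRing.Theory Num.Theory.
Import numFieldNormedType.Exports.

Local Open Scope classical_set_scope.
Local Open Scope ring_scope.

(* Given an error bound constant [C], every [x] in [S1] is, up to an arbitrarily
   small slack, at distance at most [C] times its infeasibility from some [y] in
   [S]; the [L]-Lipschitz function [Psi] loses at most [L] times this distance
   between [x] and [y], which the penalty term absorbs once [lambda >= C * L].
   Passing from [Psi x] to [Phi x] and the slack cost [eps / 2] each.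

   The existence of [C] rests on Hoffman's bound for linear inequalities, with a
   constant uniform in the right-hand side. It follows by induction on the number
   of variables via Fourier-Motzkin elimination: a point near the solution set of
   the eliminated system lifts to a nearby solution of the original one. *)

(** * Euclidean norm and sum norm *)

Section Norms.
Variables (R : realType) (k : nat).
Implicit Types u v : 'cV[R]_k.

Lemma norm1_ge0 u : 0 <= norm1 u.
Proof. exact: sumr_ge0. Qed.

Lemma norm2_ge0 u : 0 <= norm2 u.
Proof. exact: sqrtr_ge0. Qed.

Lemma norm1D u v : norm1 (u + v) <= norm1 u + norm1 v.
Proof. by rewrite /norm1 -big_split; apply: ler_sum => i _; rewrite mxE ler_normD. Qed.

Lemma norm1_0 : norm1 (0 : 'cV[R]_k) = 0.
Proof. by rewrite /norm1 big1 // => i _; rewrite mxE normr0. Qed.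

Lemma ler_norm1 u i : `|u i 0| <= norm1 u.
Proof. by rewrite /norm1 (bigD1 i) //= lerDl sumr_ge0. Qed.

Lemma norm2_sqr u : norm2 u ^+ 2 = \sum_i u i 0 ^+ 2.
Proof. by rewrite sqr_sqrtr // sumr_ge0 // => i _; rewrite sqr_ge0. Qed.

Lemma ler_norm2 u i : `|u i 0| <= norm2 u.
Proof.
rewrite -ler_sqr ?nnegrE ?norm2_ge0 // norm2_sqr (bigD1 i) //= real_normK ?num_real //.
by rewrite lerDl sumr_ge0 // => j _; rewrite sqr_ge0.
Qed.

Lemma norm2_le_norm1 u : norm2 u <= norm1 u.
Proof.
rewrite -ler_sqr ?nnegrE ?norm2_ge0 ?norm1_ge0 // norm2_sqr expr2 {2}/norm1 mulr_sumr.
apply: ler_sum => i _; rewrite -real_normK ?num_real // expr2.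
by rewrite ler_wpM2r // ler_norm1.
Qed.

Lemma norm2Z a u : norm2 (a *: u) = `|a| * norm2 u.
Proof.
apply/eqP; rewrite -(@eqrXn2 _ 2) ?norm2_ge0 ?mulr_ge0 ?norm2_ge0 //.
rewrite exprMn !norm2_sqr real_normK ?num_real // mulr_sumr.
by apply/eqP/eq_bigr => i _; rewrite mxE exprMn.
Qed.

Lemma norm2_eq0 u : norm2 u = 0 -> u = 0.
Proof.
move=> u0; apply/matrixP => i j; rewrite ord1 mxE; apply/eqP.
by rewrite -normr_le0 -u0 ler_norm2.
Qed.

Lemma cauchy_schwarz u v : \sum_i u i 0 * v i 0 <= norm2 u * norm2 v.
Proof.
have [/norm2_eq0 u0|u_neq0] := eqVneq (norm2 u) 0.
  by rewrite big1 ?mulr_ge0 ?norm2_ge0 // => i _; rewrite u0 mxE mul0r.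
have [/norm2_eq0 v0|v_neq0] := eqVneq (norm2 v) 0.
  by rewrite big1 ?mulr_ge0 ?norm2_ge0 // => i _; rewrite v0 mxE mulr0.
have uv_gt0 : 0 < norm2 u * norm2 v.
  by rewrite mulr_gt0 // lt0r ?u_neq0 ?v_neq0 norm2_ge0.
(* This sum equals [2 |u| |v| (|u| |v| - <u, v>)], with Euclidean norms; dividing by [|u| |v| > 0]
   gives the claim. *)
have : 0 <= \sum_i (norm2 v * u i 0 - norm2 u * v i 0) ^+ 2.
  by apply: sumr_ge0 => i _; rewrite sqr_ge0.
have -> : \sum_i (norm2 v * u i 0 - norm2 u * v i 0) ^+ 2 =
    norm2 v ^+ 2 * \sum_i u i 0 ^+ 2 - 2 * (norm2 u * norm2 v) * \sum_i u i 0 * v i 0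
    + norm2 u ^+ 2 * \sum_i v i 0 ^+ 2.
  rewrite !mulr_sumr -sumrB -big_split; apply: eq_bigr => i _ /=; ring.
rewrite -!norm2_sqr => ge0.
rewrite -(ler_pM2l uv_gt0); nra.
Qed.

Lemma norm2D u v : norm2 (u + v) <= norm2 u + norm2 v.
Proof.
rewrite -ler_sqr ?nnegrE ?addr_ge0 ?norm2_ge0 // norm2_sqr sqrrD !norm2_sqr.
have -> : \sum_i (u + v) i 0 ^+ 2 =
    \sum_i u i 0 ^+ 2 + (\sum_i u i 0 * v i 0) *+ 2 + \sum_i v i 0 ^+ 2.
  by rewrite -sumrMnl -!big_split; apply: eq_bigr => i _ /=; rewrite mxE sqrrD.
by rewrite lerD2r lerD2l lerMn2r cauchy_schwarz.
Qed.

Lemma norm2N u : norm2 (- u) = norm2 u.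
Proof. by rewrite -scaleN1r norm2Z normrN1 mul1r. Qed.

End Norms.

Lemma norm1_mulmx (R : realType) (m n : nat) (A : 'M[R]_(m, n)) (v : 'cV[R]_n) :
  norm1 (A *m v) <= (\sum_i \sum_j `|A i j|) * norm1 v.
Proof.
rewrite mulr_suml; apply: ler_sum => i _; rewrite mxE (le_trans (ler_norm_sum _ _ _)) //.
rewrite mulr_suml; apply: ler_sum => j _.
by rewrite normrM ler_wpM2l // ler_norm1.
Qed.

(** * Hoffman's bound for linear inequalities *)

Lemma exists_between (R : realType) (I : finType) (P Q : pred I) (lo hi : I -> R) (T : R) :
  0 <= T -> (forall i j, P i -> Q j -> lo i <= hi j) ->
  (forall i, P i -> lo i <= T) -> (forall j, Q j -> - T <= hi j) ->
  exists s, [/\ `|s| <= T, forall i, P i -> lo i <= s & forall j, Q j -> s <= hi j].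
Proof.
(* The largest lower bound; the default [- T] keeps the witness in range even when [P] is empty. *)
move=> T0 lohi loT hiT; exists (\big[Num.max/- T]_(i | P i) lo i); split.
- rewrite ler_norml bigmax_ge_id /=; apply/bigmax_leP; split => //.
  by rewrite ge0_cp.
- by move=> i Pi; rewrite le_bigmax_cond.
- by move=> j Qj; apply/bigmax_leP; split => [|i Pi]; [exact: hiT|exact: lohi].
Qed.

Section Hoffman.
Variables (R : realType) (n : nat).
Local Notation "a *d x" := ((a *m x) 0 0) (at level 40).
Implicit Types (x y z : 'cV[R]_n) (a : 'rV[R]_n).

Let dotDr a x y : a *d (x + y) = a *d x + a *d y.
Proof. by rewrite mulmxDr mxE. Qed.

Let dotDZl (a a' : 'rV[R]_n) (u v : R) x :
  (u *: a + v *: a') *d x = u * (a *d x) + v * (a' *d x).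
Proof. by rewrite mulmxDl -!scalemxAl !mxE. Qed.

Let dot_delta a (s : R) (k : 'I_n) : a *d (s *: delta_mx k 0 : 'cV[R]_n) = s * a 0 k.
Proof. by rewrite -scalemxAr -colE !mxE. Qed.

Let norm1_delta (s : R) (k : 'I_n) : norm1 (s *: delta_mx k 0 : 'cV[R]_n) = `|s|.
Proof.
rewrite /norm1 (bigD1 k) //= big1 ?addr0 => [|i ik]; rewrite !mxE.
  by rewrite eqxx mulr1.
by rewrite (negPf ik) mulr0 normr0.
Qed.

(** [K] may depend on the rows [a] only: elimination changes the right-hand side, and the error
    bound applies the estimate with right-hand sides that vary with the point. *)
Definition hoffman_bound (I : finType) (a : I -> 'rV[R]_n) (K : R) : Prop :=
  0 <= K /\ forall (c : I -> R) x (r : R), 0 <= r ->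
    (exists z, forall i, a i *d z <= c i) -> (forall i, a i *d x <= c i + r) ->
    exists z, (forall i, a i *d z <= c i) /\ norm1 (z - x) <= K * r.

Let ler_dot (I : finType) (a : I -> 'rV[R]_n) i y :
  a i *d y <= (\sum_i \sum_j `|a i 0 j|) * norm1 y.
Proof.
rewrite (le_trans (ler_norm _)) // (le_trans (ler_norm1 _ _)) //.
rewrite (le_trans (norm1_mulmx _ _)) // big_ord1 ler_wpM2r ?norm1_ge0 //.
by rewrite [leRHS](bigD1 i) //= lerDl !sumr_ge0 // => i' _; rewrite sumr_ge0.
Qed.

(* One Fourier-Motzkin step: the combinations [u a_i + v a_j] with [u, v >= 0]
   do not involve the variable [k], and their feasibility at [z'] is exactly
   solvability of the original system along the line [z' + s e_k]. *)
Let hoffman_eliminate (I : finType) (a : I -> 'rV[R]_n) (k : 'I_n)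
    (u v : I * I -> R) (K' : R) :
  (forall q, u q = if a q.1 0 k == 0 then 1
                   else if (0 < a q.1 0 k) && (a q.2 0 k < 0) then - a q.2 0 k else 0) ->
  (forall q, v q = if (0 < a q.1 0 k) && (a q.2 0 k < 0) then a q.1 0 k else 0) ->
  hoffman_bound (fun q => u q *: a q.1 + v q *: a q.2) K' ->
  exists K, hoffman_bound a K.
Proof.
move=> uE vE [K'0 hK'].
have u0 q : 0 <= u q.
  by rewrite uE; case: ifP => // _; case: ifP => // /andP[_ ?]; rewrite oppr_ge0 ltW.
have v0 q : 0 <= v q by rewrite vE; case: ifP => // /andP[? _]; rewrite ltW.
(* Every combined inequality is violated at [x] by at most [W * r]. *)
pose W := \sum_q (u q + v q).
have W0 : 0 <= W by rewrite sumr_ge0 // => q _; rewrite addr_ge0.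
have leW q : u q + v q <= W.
  by rewrite /W (bigD1 q) //= lerDl sumr_ge0 // => q' _; rewrite addr_ge0.
pose M := \sum_i \sum_j `|a i 0 j|.
have M0 : 0 <= M by rewrite sumr_ge0 // => i _; rewrite sumr_ge0.
(* Bounds all reciprocal slopes in direction [k]; vanishing coefficients are harmless since
   [0^-1 = 0]. *)
pose al := \sum_i `|a i 0 k|^-1.
have al0 : 0 <= al by rewrite sumr_ge0 // => i _; rewrite invr_ge0.
have leal i : `|a i 0 k|^-1 <= al.
  by rewrite /al (bigD1 i) //= lerDl sumr_ge0 // => j _; rewrite invr_ge0.
(* The original inequalities are violated at [z'] by at most [E * r]: [r] at [x], plus the effect of
   moving from [x] to [z']. *)
pose E := 1 + M * (K' * W).
have E0 : 0 <= E by rewrite addr_ge0 ?mulr_ge0.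
exists (K' * W + E * al); split; first by rewrite addr_ge0 ?mulr_ge0.
move=> c x r r0 [z0 z0P] xP.
have [|||z' [z'P z'x]] := hK' (fun q => u q * c q.1 + v q * c q.2) x (W * r).
- by rewrite mulr_ge0.
- by exists z0 => q; rewrite dotDZl lerD // ler_wpM2l.
- move=> q; rewrite dotDZl.
  have := ler_wpM2l (u0 q) (xP q.1); have := ler_wpM2l (v0 q) (xP q.2).
  have := ler_wpM2r r0 (leW q); lra.
rewrite mulrA in z'x.
have resE i : a i *d z' - c i <= E * r.
  rewrite -(subrK x z') dotDr /E mulrDl mul1r.
  have := ler_dot a i (z' - x); have := ler_wpM2l M0 z'x; have := xP i; rewrite -/M; lra.
pose T := E * r * al.
have T0 : 0 <= T by rewrite !mulr_ge0.
(* The value of [s] making inequality [i] tight at [z' + s e_k]: an upper bound on [s] if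
   [a i 0 k > 0], a lower bound if [a i 0 k < 0]. *)
pose bd i := (c i - a i *d z') / a i 0 k.
have [|i j ai aj|i ai|i ai|s [sT lo hi]] :=
  @exists_between R I (fun i => a i 0 k < 0) (fun i => 0 < a i 0 k) bd bd T.
- exact: T0.
(* The combination for the pair [(j, i)] is [bd i <= bd j] with denominators cleared. *)
- have := z'P (j, i); rewrite dotDZl uE vE /= ai aj /= (gt_eqF aj) => h.
  rewrite /bd ler_pdivlMr // mulrAC ler_ndivrMr //; nra.
- rewrite /bd ler_ndivrMr //.
  have h : 1 <= al * - a i 0 k.
    rewrite -ler_pdivrMr ?oppr_gt0 // mul1r.
    by have := leal i; rewrite ltr0_norm.
  have := resE i; have := ler_wpM2l (mulr_ge0 E0 r0) h; rewrite /T; lra.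
- rewrite /bd ler_pdivlMr //.
  have h : 1 <= al * a i 0 k.
    rewrite -ler_pdivrMr // mul1r.
    by have := leal i; rewrite gtr0_norm.
  have := resE i; have := ler_wpM2l (mulr_ge0 E0 r0) h; rewrite /T; lra.
exists (z' + s *: delta_mx k 0); split.
  move=> i; rewrite dotDr dot_delta.
  have [ai|ai|ai] := ltrgtP (a i 0 k) 0.
  - have := lo i ai; rewrite /bd ler_ndivrMr //; lra.
  - have := hi i ai; rewrite /bd ler_pdivlMr //; lra.
  (* With a zero coefficient, the pair [(i, i)] has [u = 1] and [v = 0], so it reproduces inequality
     [i]. *)
  - have := z'P (i, i); rewrite dotDZl uE vE /= ai eqxx ltxx /=; lra.
rewrite addrAC (le_trans (norm1D _ _)) // norm1_delta.
move: sT; rewrite /T; lra.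
Qed.

Lemma hoffman (I : finType) (a : I -> 'rV[R]_n) : exists K, hoffman_bound a K.
Proof.
(* Induction on the number [k] of leading variables that may occur; the index type is general
   because elimination replaces [J] by [J * J]. *)
suff H (k : nat) (J : finType) (a' : J -> 'rV[R]_n) :
    (forall i (j : 'I_n), (k <= j)%N -> a' i 0 j = 0) -> exists K, hoffman_bound a' K.
  by apply: (H n) => i j; rewrite leqNgt ltn_ord.
elim: k J a' => [|k IHk] J a' a'0.
  have a'00 i : a' i = 0 by apply/rowP => j; rewrite a'0 // mxE.
  (* All rows vanish, so feasibility does not depend on the point and [x] itself is a solution. *)
  exists 0; split => // c x r r0 [z zP] xP; exists x; split.
    by move=> i; have := zP i; rewrite a'00 !mul0mx.
  by rewrite subrr norm1_0 mul0r.
have [kn|nk] := ltnP k n; last first.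
  by apply: IHk => i j kj; have := ltn_ord j; rewrite ltnNge (leq_trans nk kj).
pose k0 := Ordinal kn.
pose pn q := (0 < a' q.1 0 k0) && (a' q.2 0 k0 < 0).
pose u (q : J * J) := if a' q.1 0 k0 == 0 then 1 else if pn q then - a' q.2 0 k0 else 0.
pose v (q : J * J) := if pn q then a' q.1 0 k0 else 0.
have [|K hK] := IHk _ (fun q => u q *: a' q.1 + v q *: a' q.2).
  move=> q j; rewrite !mxE leq_eqVlt => /predU1P[kj|kj]; last first.
    by rewrite !a'0 // !mulr0 addr0.
  have -> : j = k0 by apply: val_inj.
  rewrite /u /v; case: (eqVneq (a' q.1 0 k0) 0) => [e|_].
    by rewrite /pn e ltxx mul0r mulr0 addr0.
  by case: ifP => _; [ring|rewrite !mul0r addr0].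
exact: (hoffman_eliminate _ _ hK).
Qed.

End Hoffman.

(** Each equation is encoded as two opposite inequalities. *)
Lemma hoffman_mixed (R : realType) (n q m : nat) (M : 'M[R]_(q, n)) (N : 'M[R]_(m, n)) :
  exists2 K, 0 <= K &
    forall (c : 'cV[R]_q) (e : 'cV[R]_m) (x : 'cV[R]_n) (r : R), 0 <= r ->
      (exists z, le_vec (M *m z) c /\ N *m z = e) ->
      (forall i, (M *m x) i 0 <= c i 0 + r) -> (forall i, `|(N *m x - e) i 0| <= r) ->
      exists z, [/\ le_vec (M *m z) c, N *m z = e & norm1 (z - x) <= K * r].
Proof.
pose a (i : 'I_q + ('I_m + 'I_m)) : 'rV[R]_n :=
  match i with inl i => row i M | inr (inl i) => row i N | inr (inr i) => - row i N end.
have rowE (s : nat) (P : 'M[R]_(s, n)) i x : (row i P *m x) 0 0 = (P *m x) i 0.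
  by rewrite -row_mul mxE.
have rowNE (s : nat) (P : 'M[R]_(s, n)) i x : (- row i P *m x) 0 0 = - (P *m x) i 0.
  by rewrite mulNmx mxE rowE.
have [K [K0 hK]] := hoffman a.
exists K => // c e x r r0 [z0 [z0c z0e]] xc xe.
pose rhs (i : 'I_q + ('I_m + 'I_m)) : R :=
  match i with inl i => c i 0 | inr (inl i) => e i 0 | inr (inr i) => - e i 0 end.
have [||z [zP zx]] := hK rhs x r r0.
- by exists z0 => -[i|[i|i]] /=; rewrite ?rowE ?rowNE // z0e.
- move=> [i|[i|i]] /=; rewrite ?rowE ?rowNE //.
    by have := xe i; rewrite mxE [(- e) i 0]mxE ler_norml => /andP[]; lra.
  by have := xe i; rewrite mxE [(- e) i 0]mxE ler_norml => /andP[]; lra.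
exists z; split => //.
  by move=> i; have := zP (inl i); rewrite /= rowE.
apply/matrixP => i j; rewrite ord1; apply/eqP; rewrite eq_le.
have := zP (inr (inl i)); have := zP (inr (inr i)); rewrite /= rowE rowNE lerN2.
by move=> -> ->.
Qed.

(** * Positive parts as measures of violation *)

Section PositivePart.
Variable R : realType.

Lemma pos_part_ge0 (a : R) : 0 <= pos_part a.
Proof. by rewrite le_max lexx orbT. Qed.

Lemma le_pos_part (a : R) : a <= pos_part a.
Proof. by rewrite le_max lexx. Qed.

Lemma pos_part_eq0 (a : R) : a <= 0 -> pos_part a = 0.
Proof. by move=> a0; rewrite /pos_part max_r. Qed.

Lemma pos_part_le (a c : R) : 0 <= c -> a <= c -> pos_part a <= c.
Proof. by move=> c0 ac; rewrite ge_max ac c0. Qed.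

Lemma le_norm1_pos_part (k : nat) (u v : 'cV[R]_k) i :
  u i 0 <= v i 0 + norm1 (pos_part_vec (u - v)).
Proof.
rewrite -lerBlDl (le_trans _ (ler_norm1 _ i)) // (le_trans _ (ler_norm _)) //.
by rewrite !mxE le_pos_part.
Qed.

Lemma norm1_pos_part_eq0 (k : nat) (u v : 'cV[R]_k) :
  le_vec u v -> norm1 (pos_part_vec (u - v)) = 0.
Proof.
move=> uv; rewrite /norm1 big1 // => i _; rewrite !mxE pos_part_eq0 ?normr0 //.
by rewrite subr_le0.
Qed.

End PositivePart.

(** * Distance to the feasible set and the error bound *)

Lemma dist_set_le (R : realType) (n : nat) (S : set 'cV[R]_n) (x y : 'cV[R]_n) :
  S y -> dist_set x S <= norm2 (x - y).
Proof.
move=> Sy; apply: ge_inf; last by exists y.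
by exists 0 => _ [z _ <-]; rewrite norm2_ge0.
Qed.

(* Move [x] to a point [y] of the polyhedron [Dy <= d, By <= h], contract [A y]
   towards [A x0] until it enters the ball, and lift this motion back to the
   polyhedron by the Hoffman bound. Moving [y] itself towards [x0] would fail:
   [y - x0] is unbounded, whereas [A (y - x0)] is not. *)
Lemma error_bound_exists (R : realType) (n m l p : nat)
    (A : 'M[R]_(m, n)) (b : 'cV[R]_m) (sigma : R)
    (B : 'M[R]_(l, n)) (h : 'cV[R]_l) (D : 'M[R]_(p, n)) (d : 'cV[R]_p)
    (x0 : 'cV[R]_n) :
  (S1 D d `&` S2 A b sigma B h) x0 -> norm2 (A *m x0 - b) < sigma ->
  exists C, error_bound_constant A b sigma B h D d C.
Proof.
move=> [x0D [_ x0B]] x0A.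
have sg0 : 0 < sigma by apply: le_lt_trans x0A; exact: norm2_ge0.
pose s := sigma - norm2 (A *m x0 - b).
have s0 : 0 < s by rewrite subr_gt0.
pose P := col_mx D B; pose c := col_mx d h.
have PE z : le_vec (P *m z) c <-> le_vec (D *m z) d /\ le_vec (B *m z) h.
  rewrite /P /c mul_col_mx; split=> [H|[H1 H2] i].
    split=> i; first by have := H (lshift _ i); rewrite !col_mxEu.
    by have := H (rshift _ i); rewrite !col_mxEd.
  by case: (split_ordP i) => j ->; rewrite ?col_mxEu ?col_mxEd.
have [K1 K10 hK1] := hoffman_mixed P (0 : 'M[R]_(0, n)).
have [K2 K20 hK2] := hoffman_mixed P A.
pose M := \sum_i \sum_j `|A i j|.
have M0 : 0 <= M by rewrite sumr_ge0 // => i _; rewrite sumr_ge0.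
(* Cost of entering the ball per unit of excess [de]: below, [A y] moves by at most
   [t * (de + 2 * sigma)], which is at most [de * (1 + 2 * sigma / s)]. *)
pose k2 := K2 * (1 + 2 * sigma / s).
have k20 : 0 <= k2.
  by rewrite mulr_ge0 // addr_ge0 // divr_ge0 ?mulr_ge0 // ltW.
(* [K1] pays for reaching the polyhedron and the [k2] terms for entering the ball; the final [1]
   ensures positivity. *)
exists (K1 + k2 * (M * K1) + k2 / sigma + 1); split.
  have isg0 : 0 <= sigma^-1 by rewrite invr_ge0 ltW.
  have := mulr_ge0 k20 (mulr_ge0 M0 K10); have := mulr_ge0 k20 isg0; lra.
move=> x.
set g := pos_part _; set gB := norm1 _; set gD := norm1 _.
have g0 : 0 <= g by exact: pos_part_ge0.
have gB0 : 0 <= gB by exact: norm1_ge0.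
have gD0 : 0 <= gD by exact: norm1_ge0.
have [||||y [yP _ yx]] := hK1 c (0 : 'cV[R]_0) x (gB + gD).
- exact: addr_ge0.
- by exists x0; split; [exact/PE|apply/matrixP => -[]].
- move=> i; rewrite /P /c mul_col_mx; case: (split_ordP i) => j ->.
    by rewrite !col_mxEu (le_trans (le_norm1_pos_part _ d _)) // lerD2l -/gD lerDr.
  by rewrite !col_mxEd (le_trans (le_norm1_pos_part _ h _)) // lerD2l -/gB lerDl.
- by case.
pose de := pos_part (norm2 (A *m y - b) - sigma).
have de0 : 0 <= de by exact: pos_part_ge0.
have Ay : norm2 (A *m y - b) <= sigma + de.
  by rewrite -lerBlDl le_pos_part.
have Ax : norm2 (A *m x - b) <= sigma + g / sigma.
  rewrite -lerBlDl ler_pdivlMr //.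
  (* Outside the ball, [N^2 - sigma^2 = (N - sigma) (N + sigma) >= sigma (N - sigma)] with [N] the
     norm of [A x - b]. *)
  have := le_pos_part (norm2 (A *m x - b) ^+ 2 - sigma ^+ 2); rewrite -/g.
  have := norm2_ge0 (A *m x - b); have := sg0; move: g0.
  have [|] := lerP (norm2 (A *m x - b)) sigma; nra.
have de_le : de <= g / sigma + M * K1 * (gB + gD).
  apply: pos_part_le; first by rewrite !(addr_ge0, mulr_ge0) ?invr_ge0 // ltW.
  have -> : A *m y - b = A *m (y - x) + (A *m x - b).
    by rewrite mulmxBr addrA subrK.
  have := norm2D (A *m (y - x)) (A *m x - b).
  have := le_trans (norm2_le_norm1 _) (norm1_mulmx A (y - x)); rewrite -/M.
  have := ler_wpM2l M0 yx; move: Ax; lra.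
(* Chosen so that [(1 - t) (sigma + de) + t (sigma - s) = sigma]. *)
pose t := de / (de + s).
have ds0 : 0 < de + s by rewrite ltr_wpDl.
have tE : t * (de + s) = de by rewrite divfK // gt_eqF.
have t0 : 0 <= t by rewrite divr_ge0 // ltW.
have t1 : t <= 1 by rewrite ler_pdivrMr // mul1r lerDl ltW.
have [yD yB] := (PE y).1 yP.
pose z0 := (1 - t) *: y + t *: x0.
have convex_le k (Q : 'M[R]_(k, n)) (e : 'cV[R]_k) :
    le_vec (Q *m y) e -> le_vec (Q *m x0) e -> le_vec (Q *m z0) e.
  move=> Qy Qx0 i.
  have -> : (Q *m z0) i 0 = (1 - t) * (Q *m y) i 0 + t * (Q *m x0) i 0.
    by rewrite /z0 mulmxDr -!scalemxAr [LHS]mxE; congr (_ + _); rewrite [LHS]mxE.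
  have t1' : 0 <= 1 - t by rewrite subr_ge0.
  have := ler_wpM2l t1' (Qy i); have := ler_wpM2l t0 (Qx0 i); lra.
(* [z0] is feasible but possibly far from [y]; it only witnesses solvability, and [z] is a nearby
   point with the same image under [A]. *)
have [||||z [zP zA zy]] := hK2 c (A *m z0) y (de * (1 + 2 * sigma / s)).
- by rewrite mulr_ge0 // addr_ge0 // divr_ge0 ?mulr_ge0 // ltW.
- by exists z0; split => //; apply/PE; split; apply: convex_le.
- move=> i; apply: (le_trans (yP i)).
  by rewrite lerDl mulr_ge0 // addr_ge0 // divr_ge0 ?mulr_ge0 // ltW.
- move=> i; apply: (le_trans (ler_norm2 _ _)).
  have -> : A *m y - A *m z0 = t *: ((A *m y - b) - (A *m x0 - b)).
    rewrite /z0 mulmxDr -!scalemxAr opprB addrA subrK scalerBr scalerBl scale1r.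
    by rewrite opprD opprB addrA addrCA subrr addr0.
  rewrite norm2Z ger0_norm //.
  have dif : norm2 ((A *m y - b) - (A *m x0 - b)) <= de + 2 * sigma.
    have := norm2D (A *m y - b) (- (A *m x0 - b)); rewrite norm2N.
    move: Ay x0A; lra.
  apply: (le_trans (ler_wpM2l t0 dif)).
  rewrite /t mulrAC ler_pdivrMr // -[leRHS]mulrA ler_wpM2l //.
  have ss : 2 * sigma / s * s = 2 * sigma by rewrite divfK // gt_eqF.
  have q0 : 0 <= 2 * sigma / s by rewrite divr_ge0 ?mulr_ge0 // ltW.
  have := mulr_ge0 q0 de0; have := s0; lra.
have zS : (S1 D d `&` S2 A b sigma B h) z.
  have [zD zB] := (PE z).1 zP; split => //; split => //.
  have -> : A *m z - b = (1 - t) *: (A *m y - b) + t *: (A *m x0 - b).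
    rewrite zA /z0 mulmxDr -!scalemxAr !scalerBr [in RHS]addrACA -opprD -scalerDl.
    by rewrite subrK scale1r.
  apply: (le_trans (norm2D _ _)); rewrite !norm2Z !ger0_norm ?subr_ge0 //.
  have t1' : 0 <= 1 - t by rewrite subr_ge0.
  have := ler_wpM2l t1' Ay; move: tE; rewrite /s; lra.
apply: (le_trans (dist_set_le _ zS)).
have xz : norm2 (x - z) <= norm1 (z - y) + norm1 (y - x).
  rewrite -norm2N opprB (le_trans (norm2_le_norm1 _)) //.
  by rewrite (le_trans _ (norm1D _ _)) // addrA subrK.
have := ler_wpM2l k20 de_le.
have zy' : norm1 (z - y) <= k2 * de by rewrite /k2 mulrAC -mulrA.
have := mulr_ge0 K10 g0.
have := mulr_ge0 (mulr_ge0 k20 (mulr_ge0 M0 K10)) g0.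
have isg0 : 0 <= sigma^-1 by rewrite invr_ge0 ltW.
have := mulr_ge0 (mulr_ge0 k20 isg0) (addr_ge0 gB0 gD0).
move: yx xz zy' g0 gB0 gD0; lra.
Qed.

(** * Exact penalization *)

Lemma exact_penalty (R : realType) (n m l p : nat)
    (A : 'M[R]_(m, n)) (b : 'cV[R]_m) (sigma : R)
    (B : 'M[R]_(l, n)) (h : 'cV[R]_l) (D : 'M[R]_(p, n)) (d : 'cV[R]_p)
    (Phi Psi : 'cV[R]_n -> R) (eps L C lambda : R) (xstar : 'cV[R]_n) :
  0 < eps -> 0 < L -> 0 <= sigma -> lipschitz_approximation L (eps / 2) Phi Psi ->
  global_minimizer Phi (S1 D d `&` S2 A b sigma B h) xstar ->
  error_bound_constant A b sigma B h D d C -> C * L <= lambda ->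
  eps_minimizer (penalized A b sigma B h Phi lambda) (S1 D d) eps xstar.
Proof.
move=> eps0 L0 sg0 [Lip app] [[xD [xA xB]] xmin] [C0 hC] CL; split => //.
have -> : penalized A b sigma B h Phi lambda xstar = Phi xstar.
  rewrite /penalized norm1_pos_part_eq0 // pos_part_eq0 ?addr0 ?mulr0 ?add0r //.
  by rewrite subr_le0 ler_sqr ?nnegrE ?norm2_ge0.
rewrite -lerBlDr; apply: lb_le_inf; first by eexists; exists xstar.
move=> _ [x xS <-]; rewrite /penalized.
(* On [S1] the term for [D] vanishes, leaving exactly the penalized quantity. *)
have := hC x; rewrite (norm1_pos_part_eq0 xS) addr0.
set g := (_ + _) => dist_le.
have g0 : 0 <= g by rewrite addr_ge0 ?pos_part_ge0 ?norm1_ge0.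
(* A near-minimizer of the distance suffices: the slack [eps / 2 / L] becomes [eps / 2] after
   multiplication by [L]. *)
have [||_ [y yS <-] y_lt] := @inf_adherent R
    [set norm2 (x - y) | y in S1 D d `&` S2 A b sigma B h] (eps / 2 / L).
- by rewrite !divr_gt0.
- split; first by exists (norm2 (x - xstar)), xstar.
  by exists 0 => _ [y _ <-]; rewrite norm2_ge0.
have {}y_lt : norm2 (x - y) <= C * g + eps / 2 / L.
  by apply: ltW; apply: (lt_le_trans y_lt); rewrite lerD2r.
have := ler_wpM2l (ltW L0) y_lt.
have -> : L * (C * g + eps / 2 / L) = C * L * g + eps / 2.
  by field; rewrite gt_eqF.
have := ler_wpM2r g0 CL.
have := Lip x y; rewrite ler_norml => /andP[+ _].
have /andP[+ _] := app y; have /andP[_ +] := app x.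
have := xmin y yS; lra.
Qed.

Theorem theorem3p3 (R : realType) (n m l p : nat)
    (A : 'M[R]_(m, n)) (b : 'cV[R]_m) (sigma : R)
    (B : 'M[R]_(l, n)) (h : 'cV[R]_l)
    (D : 'M[R]_(p, n)) (d : 'cV[R]_p)
    (Phi : 'cV[R]_n -> R)
    (Phi_ge0 : forall x, 0 <= Phi x)
    (Phi_cont : continuous Phi)
    (A_full_row_rank : row_free A)
    (sigma_ge0 : 0 <= sigma)
    (slater : exists x0 : 'cV[R]_n,
      (S1 D d `&` S2 A b sigma B h) x0 /\ norm2 (A *m x0 - b) < sigma)
    (eps L : R) (eps_gt0 : 0 < eps) (L_gt0 : 0 < L)
    (Psi : 'cV[R]_n -> R)
    (Psi_approx : lipschitz_approximation L (eps / 2) Phi Psi)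
    (xstar : 'cV[R]_n)
    (xstar_min : global_minimizer Phi (S1 D d `&` S2 A b sigma B h) xstar) :
  (exists lambdastar : R, 0 < lambdastar /\
     forall lambda : R, lambdastar <= lambda ->
       eps_minimizer (penalized A b sigma B h Phi lambda) (S1 D d) eps xstar) /\
  (forall C : R, error_bound_constant A b sigma B h D d C ->
     forall lambda : R, C * L <= lambda ->
       eps_minimizer (penalized A b sigma B h Phi lambda) (S1 D d) eps xstar).
Proof.
have part2 C : error_bound_constant A b sigma B h D d C ->
    forall lambda : R, C * L <= lambda ->
      eps_minimizer (penalized A b sigma B h Phi lambda) (S1 D d) eps xstar.
  move=> hC lambda CL.
  exact: (exact_penalty eps_gt0 L_gt0 sigma_ge0 Psi_approx xstar_min hC CL).
split=> //.
have [x0 [x0S x0A]] := slater.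
have [C hC] := error_bound_exists x0S x0A.
by exists (C * L); split; [rewrite mulr_gt0 //; case: hC|exact: part2].
Qed.
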